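(* Assume that the following holds: for every odd prime $p\equiv 1\pmod 4$, $C_{NQ}\oplus C_{NQ}^\perp=\mathbb{F}^{2p}$ (in particular $C_{NQ}\cap C_{NQ}^\perp=\{\mathbf 0\}$), and for every prime $p\equiv 3\pmod 4$, $C_{NQ}^\perp=C_{NQ}$, where $C_{NQ}$ is the QQR code associated to $p$. Then there is a constant $p_0$ having the following property: if $p>p_0$ is a prime then there is a non-empty subset $S\subseteq GF(p)$ for which $|X_S(GF(p))|>1.62\,p$.
   Context: Let $p$ be an odd prime, $\mathbb{F}=GF(2)$, $R=\mathbb{F}[x]/(x^p-1)$, and for $S\subseteq GF(p)$ let $r_S=\sum_{i\in S}x^i\in R$ (with $r_\emptyset=0$). Elements of $R$ are identified with vectors in $\mathbb{F}^p$ via their coefficients. Let $Q,N\subset GF(p)^\times$ be the sets of quadratic residues and non-residues. The QQR code is $C_{NQ}=\{(r_Nr_S,r_Qr_S)\mid S\subseteq GF(p)\}\subseteq\mathbb{F}^{2p}$. $C^\perp$ denotes the dual code with respect to the standard dot product. For a non-empty subset $S\subseteq GF(p)$ let $f_S(x)=\prod_{a\in S}(x-a)\in GF(p)[x]$, and let $X_S$ be the hyperelliptic curve $y^2=f_S(x)$. $|X_S(GF(p))|$ denotes the number of solutions $(x,y)\in GF(p)^2$ of $y^2=f_S(x)$ plus the number of points at infinity, which is $2$ if $|S|$ is even and $1$ if $|S|$ is odd. *)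

(* Defs.v *)
From mathcomp Require Import all_boot all_order all_algebra.

Set Implicit Arguments.
Unset Strict Implicit.
Unset Printing Implicit Defensive.

Import Order.TTheory GRing.Theory Num.Theory.
Local Open Scope ring_scope.

(* The definitions below take an arbitrary p : nat, but 'F_p is GF(p) only
   for p prime; they are meant to be used at odd primes. *)

(* The exponent i : 'F_p is read as its representative in {0, ..., p - 1}. *)
Definition r_ (p : nat) (S : {set 'F_p}) : {poly %/ ('X^p - 1 : {poly 'F_2})} :=
  \sum_(i in S) 'qX ^+ i.

Definition quad_residues (p : nat) : {set 'F_p} :=
  [set a : 'F_p | (a != 0) && [exists b : 'F_p, a == b ^+ 2]].

Definition quad_nonresidues (p : nat) : {set 'F_p} :=
  [set a : 'F_p | (a != 0) && ~~ [exists b : 'F_p, a == b ^+ 2]].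

(* Elements of the quotient are stored as reduced polynomials, so for 0 < p
   this is the coordinate vector in the basis 1, x, ..., x^(p-1). *)
Definition coef_vec (p : nat) (u : {poly %/ ('X^p - 1 : {poly 'F_2})}) :
    'rV['F_2]_p :=
  \row_(i < p) (u : {poly 'F_2})`_i.

Definition QQR_codeword (p : nat) (S : {set 'F_p}) : 'rV['F_2]_(p + p) :=
  row_mx (coef_vec (r_ (quad_nonresidues p) * r_ S))
         (coef_vec (r_ (quad_residues p) * r_ S)).

Definition QQR_code (p : nat) : {set 'rV['F_2]_(p + p)} :=
  [set QQR_codeword S | S : {set 'F_p}].

Definition dot (n : nat) (u v : 'rV['F_2]_n) : 'F_2 :=
  \sum_(i < n) u 0 i * v 0 i.

Definition dual_code (n : nat) (C : {set 'rV['F_2]_n}) : {set 'rV['F_2]_n} :=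
  [set v | [forall u in C, dot u v == 0]].

Definition is_direct_sum (n : nat) (C D : {set 'rV['F_2]_n}) : Prop :=
  C :&: D = [set 0] /\ [set u + v | u in C, v in D] = [set: 'rV['F_2]_n].

Definition f_ (p : nat) (S : {set 'F_p}) : {poly 'F_p} :=
  \prod_(a in S) ('X - a%:P).

Definition affine_points (p : nat) (S : {set 'F_p}) : {set 'F_p * 'F_p} :=
  [set xy : 'F_p * 'F_p | xy.2 ^+ 2 == (f_ S).[xy.1]].

Definition points_at_infinity (p : nat) (S : {set 'F_p}) : nat :=
  if odd #|S| then 1%N else 2%N.

Definition card_X (p : nat) (S : {set 'F_p}) : nat :=
  (#|affine_points S| + points_at_infinity S)%N.

(* Main.v *)
Require Import Defs.
From mathcomp Require Import all_boot all_order all_algebra.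
From mathcomp Require Import all_fingroup all_solvable zify ring lra.

(* For |S| even the codeword of S has weight p - sum_x chi(f_S(x)), chi being
   the quadratic character, so |X_S(GF(p))| = 2p + 2 - weight. The words with
   |S| even form a code of length n = 2p with 2^(p-1) words, and it suffices
   that such a code has a nonzero word of weight below 0.38 p = 0.19 n. This is
   the first linear programming (MRRW) bound, whose limit at rate 1/2 is
   0.1871 n. It is proved by the method of Navon and Samorodnitsky: take f >= 0
   supported on a Hamming ball B with A f >= lam f pointwise, A being the
   adjacency operator of the cube, which multiplies the Fourier coefficient at
   c by n - 2 wt(c). Summing the squared coefficients over the code C and using
   the Cauchy-Schwarz inequality on B gives |C| <= n |B| as soon as
   lam >= 1 + max (n - 2 wt(c)) over c <> 0. For radius n * 5/46 one gets
   lam > 0.62 n, while n |B| is exponentially smaller than 2^(p-1). *)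

Set Implicit Arguments.
Unset Strict Implicit.
Unset Printing Implicit Defensive.

Import Order.TTheory GRing.Theory Num.Theory.
Local Open Scope ring_scope.

(** * Fourier analysis on the cube of subsets of [T] *)

Definition flip (T : finType) (i : T) (X : {set T}) : {set T} :=
  if i \in X then X :\ i else i |: X.

Lemma flipK (T : finType) (i : T) : involutive (flip i).
Proof.
move=> X; rewrite /flip; case: (boolP (i \in X)) => iX.
  by rewrite setD11 setD1K.
by rewrite setU11 setU1K.
Qed.

(** A Walsh function: for [e] = (-1)^c it is (-1) to the number of i in [X] with c_i = 1. *)
Definition character (R : comNzRingType) (T : finType) (e : T -> R)
    (X : {set T}) : R :=
  \prod_(i in X) e i.

Lemma character_flip (R : comNzRingType) (T : finType) (e : T -> R)
    (i : T) (X : {set T}) :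
  e i ^+ 2 = 1 -> character e (flip i X) = e i * character e X.
Proof.
move=> e2; rewrite /flip /character; case: ifP => iX.
  by rewrite [in RHS](big_setD1 i) //= mulrA -expr2 e2 mul1r.
by rewrite big_setU1 // iX.
Qed.

Definition fourier (R : comNzRingType) (T : finType) (f : {set T} -> R)
    (e : T -> R) : R :=
  \sum_X f X * character e X.

Lemma fourier_neighbours (R : comNzRingType) (T : finType) (f : {set T} -> R)
    (e : T -> R) :
  (forall i, e i ^+ 2 = 1) ->
  fourier (fun X => \sum_i f (flip i X)) e = (\sum_i e i) * fourier f e.
Proof.
move=> e2; rewrite /fourier mulr_suml.
under eq_bigr do rewrite mulr_suml.
rewrite exchange_big; apply: eq_bigr => i _ /=.
rewrite mulr_sumr (reindex_inj (inv_inj (flipK i))).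
by apply: eq_bigr => X _; rewrite flipK character_flip // mulrCA.
Qed.

Lemma sum_fourierM (R : comNzRingType) (T U : finType) (P : pred U)
    (e : U -> T -> R) (f g : {set T} -> R) :
  \sum_(u | P u) fourier f (e u) * fourier g (e u) =
  \sum_X \sum_Y f X * g Y *
    \sum_(u | P u) character (e u) X * character (e u) Y.
Proof.
rewrite /fourier.
under eq_bigr do rewrite big_distrlr /=.
rewrite exchange_big; apply: eq_bigr => X _ /=.
rewrite exchange_big; apply: eq_bigr => Y _ /=.
by rewrite mulr_sumr; apply: eq_bigr => u _; rewrite mulrACA.
Qed.

(** The nonnegative kernel makes the sum of [fourier g (e u) * fourier f (e u)] nonnegative whenever
    g >= 0. Taking g = A f - lam f gives a lower bound for the sum of (sum of signs) * F^2;
    isolating [u0] gives an upper bound. The diagonal X = Y of the kernel bounds [E] from below. *)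
Lemma spectral_bound (R : realFieldType) (T U : finType) (P : pred U) (u0 : U)
    (e : U -> T -> R) (f : {set T} -> R) (lam mu : R) :
  (forall u i, e u i ^+ 2 = 1) ->
  P u0 -> (forall i, e u0 i = 1) ->
  (forall X Y,
    0 <= \sum_(u | P u) character (e u) X * character (e u) Y) ->
  (forall u, P u -> u != u0 -> \sum_i e u i <= mu) ->
  (forall X, 0 <= f X) ->
  (forall X, lam * f X <= \sum_i f (flip i X)) ->
  mu <= lam ->
  (lam - mu) * (#|P|%:R * \sum_X f X ^+ 2) <= (#|T|%:R - mu) * (\sum_X f X) ^+ 2.
Proof.
move=> e2 Pu0 e0 K0 emu f0 flam lemulam.
pose F u := fourier f (e u).
pose E := \sum_(u | P u) F u ^+ 2.
have sum_ge0 (g : {set T} -> R) : (forall X, 0 <= g X) ->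
    0 <= \sum_(u | P u) fourier g (e u) * F u.
  move=> g0; rewrite sum_fourierM; apply: sumr_ge0 => X _.
  by apply: sumr_ge0 => Y _; rewrite !mulr_ge0.
have Fu0 : F u0 = \sum_X f X.
  apply: eq_bigr => X _; rewrite /character big1 ?mulr1 // => i _.
have lamE : lam * E <= \sum_(u | P u) (\sum_i e u i) * F u ^+ 2.
  rewrite -subr_ge0 /E mulr_sumr -sumrB.
  rewrite (eq_bigr (fun u => fourier
    (fun X => \sum_i f (flip i X) - lam * f X) (e u) * F u)) => [|u _].
    by apply: sum_ge0 => X; rewrite subr_ge0.
  rewrite !expr2 !mulrA -mulrBl -fourier_neighbours //; congr (_ * _).
  rewrite /F /fourier mulr_sumr -sumrB.
  by apply: eq_bigr => X _; rewrite mulrBl mulrA.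
have leE : \sum_(u | P u) (\sum_i e u i) * F u ^+ 2 <=
    #|T|%:R * F u0 ^+ 2 + mu * (E - F u0 ^+ 2).
  rewrite /E [in leLHS](bigD1 u0) //= [in leRHS](bigD1 u0) //=.
  rewrite addrAC subrr add0r mulr_sumr lerD //.
    by under eq_bigr do rewrite e0; rewrite sumr_const.
  apply: ler_sum => u /andP[Pu uN0].
  by rewrite ler_wpM2r ?sqr_ge0 ?emu.
have geE : #|P|%:R * \sum_X f X ^+ 2 <= E.
  rewrite /E; under [leRHS]eq_bigr do rewrite expr2.
  rewrite sum_fourierM mulr_sumr; apply: ler_sum => X _.
  rewrite (bigD1 X) //= -expr2 mulrC.
  rewrite [X in _ * X + _](_ : _ = #|P|%:R).
    by rewrite lerDl; apply: sumr_ge0 => Y _; rewrite !mulr_ge0.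
  rewrite -sum1_card natr_sum; apply: eq_bigr => u _.
  rewrite /character -big_split /= big1 // => i _.
  by rewrite -expr2.
have : (lam - mu) * (#|P|%:R * \sum_X f X ^+ 2) <= (lam - mu) * E.
  by rewrite ler_wpM2l ?subr_ge0.
rewrite -Fu0; lra.
Qed.

(** * Sums over even subsets and the volume of a ball *)

Lemma sum_even_prod (R : comNzRingType) (A : finType) (m : A -> R) :
  2%:R * \sum_(S : {set A} | ~~ odd #|S|) \prod_(a in S) m a =
  \prod_a (1 + m a) + \prod_a (1 - m a).
Proof.
under eq_bigr do rewrite addrC.
under [in X in _ + X]eq_bigr do rewrite addrC.
rewrite !bigA_distr -big_split /= mulr_sumr [LHS]big_mkcond.
apply: eq_bigr => S _.
rewrite -!big_mkcond /= prodrN; case: ifPn => [/negbTE | /negbNE] oddS.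
  by rewrite -signr_odd oddS mul1r mulr_natl mulr2n.
by rewrite -signr_odd oddS mulN1r addrN.
Qed.

Lemma sum_even_prod_ge0 (R : realFieldType) (A : finType) (m : A -> R) :
  (forall a, m a ^+ 2 = 1) ->
  0 <= \sum_(S : {set A} | ~~ odd #|S|) \prod_(a in S) m a.
Proof.
move=> m2; rewrite -(pmulr_rge0 _ (ltr0Sn R 1)) sum_even_prod.
by rewrite addr_ge0 //; apply: prodr_ge0 => a _; have := m2 a; nra.
Qed.

(** This is [sum_even_prod] at m = 1. The product of the factors 1 - 1 is 0 except for empty [A],
    where it is 1; hence an inequality. *)
Lemma card_even_sets (A : finType) :
  (2 ^ #|A| <= 2 * #|[pred S : {set A} | ~~ odd #|S|]|)%N.
Proof.
have sumE : \sum_(S : {set A} | ~~ odd #|S|) \prod_(a in S) (1 : rat) =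
    #|[pred S : {set A} | ~~ odd #|S|]|%:R.
  by rewrite -sum1_card natr_sum; apply: eq_bigr => S _; rewrite big1.
rewrite -(ler_nat rat) natrM -sumE (sum_even_prod (fun=> 1)) subrr !prodr_const.
by rewrite -mulr2n natrX lerDl exprn_ge0.
Qed.

(** Chernoff's argument: expand the right side as the sum of x^|X| and keep the sets of the ball,
    for which x^|X| >= x^r. *)
Lemma card_ball_bound (R : realFieldType) (T : finType) (r : nat) (x : R) :
  0 <= x <= 1 ->
  #|[set X : {set T} | (#|X| < r)%N]|%:R * x ^+ r <= (1 + x) ^+ #|T|.
Proof.
move=> /andP[x0 x1]; rewrite -prodr_const; under eq_bigr do rewrite addrC.
rewrite bigA_distr [leRHS](eq_bigr (fun X : {set T} => x ^+ #|X|)); last first.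
  by move=> X _; rewrite -big_mkcond prodr_const.
rewrite -sum1_card natr_sum mulr_suml.
rewrite [leRHS](bigID (fun X : {set T} => (#|X| < r)%N)) /=.
rewrite -[leLHS]addr0 lerD ?sumr_ge0 // => [|X _]; last by rewrite exprn_ge0.
rewrite (eq_bigl (fun X : {set T} => (#|X| < r)%N)); last by move=> X; rewrite inE.
apply: ler_sum => X Xr; rewrite mul1r ler_wiXn2l // ltnW //.
Qed.

(** * The test function and the bound on the size of a code *)

Lemma sum_flip_card (R : comNzRingType) (T : finType) (g : nat -> R)
    (X : {set T}) :
  \sum_i g #|flip i X| =
  #|X|%:R * g #|X|.-1 + (#|T| - #|X|)%:R * g #|X|.+1.
Proof.
rewrite (bigID (mem X)) /=; congr (_ + _).
  rewrite (eq_bigr (fun=> g #|X|.-1)) ?sumr_const ?mulr_natl // => i iX.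
  by rewrite /flip iX (cardsD1 i X) iX.
rewrite (eq_bigr (fun=> g #|X|.+1)) => [|i /negbTE iX].
  by rewrite sumr_const mulr_natl -(cardC (mem X)) addKn.
by rewrite /flip iX cardsU1 iX.
Qed.

(* The function f(X) = c^|X| j (m + 1 - j), with |X| = k + j, is almost an
   eigenvector: j (m + 1 - j) has constant second difference -2, and the
   factor c^|X|, c^2 ~ k / (n - k), balances the up and down degrees of the
   cube. *)
Lemma shell_test_function (R : realFieldType) (T : finType) (k m : nat)
    (c b : R) :
  (0 < m)%N -> (k + m <= #|T|)%N -> 0 < c -> 0 <= b ->
  b * c <= k%:R -> b <= (#|T| - (k + m))%:R * c ->
  exists f : {set T} -> R,
  [/\ forall X, 0 <= f X,
      exists X, f X != 0,
      forall X, f X != 0 -> (#|X| <= k + m)%N &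
      forall X, 2%:R * b * (1 - m%:R^-1) * f X <= \sum_i f (flip i X)].
Proof.
move=> m0 kmT c0 b0 bk bT.
(* Truncated subtraction makes [h] vanish at 0 and beyond m, so [g] lives on the shell k < j <= k +
   m. *)
pose h (j : nat) : nat := (j * (m.+1 - j))%N.
pose g j : R := c ^+ j * (h (j - k)%N)%:R.
have g0 j : 0 <= g j by rewrite mulr_ge0 ?exprn_ge0 ?ler0n ?ltW.
have gN0 j : g j != 0 -> (k < j <= k + m)%N.
  apply: contraNT; rewrite negb_and -!leqNgt -ltnNge => /orP[jk | kmj].
    by rewrite /g /h (eqP jk) mul0n mulr0.
  rewrite /g /h (_ : m.+1 - (j - k) = 0)%N ?muln0 ?mulr0 //.
  apply/eqP; rewrite subn_eq0 leq_subRL ?addnS //.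
  by apply: leq_trans kmj; rewrite -addnS leq_addr.
exists (fun X : {set T} => g #|X|); split => //.
- exists [set x in take (k + 1) (enum T)].
  rewrite cardsE (card_uniqP _) ?take_uniq ?enum_uniq //.
  rewrite size_takel -?cardE ?(leq_trans _ kmT) ?leq_add2l //.
  rewrite /g /h addKn subn1 mul1n mulf_neq0 //.
    by rewrite expf_neq0 ?gt_eqF.
  by rewrite pnatr_eq0 -lt0n.
- by move=> X /gN0 /andP[].
move=> X; have [-> | gX] := eqVneq (g #|X|) 0.
  by rewrite mulr0 sumr_ge0.
rewrite (sum_flip_card g); have /andP[kX Xkm] := gN0 _ gX.
have [j cX] : exists j, #|X| = (k + j.+1)%N.
  by exists (#|X| - k.+1)%N; rewrite -addSnnS subnKC.
have [l ml] : exists l, m = (j + l).+1.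
  by exists (m - j.+1)%N; rewrite -addSn subnKC // -(leq_add2l k) -cX.
rewrite cX /g addKn addnS /= addKn -!addnS addKn.
have -> : h j = (j * l.+2)%N by rewrite /h ml -addnS -addnS addKn.
have -> : h j.+1 = (j.+1 * l.+1)%N by rewrite /h ml subSS -addnS addKn.
have -> : h j.+2 = (j.+2 * l)%N by rewrite /h ml !subSS addKn.
have {}bk : b * c <= (k + j.+1)%:R.
  by rewrite (le_trans bk) // ler_nat leq_addr.
have {}bT : b <= (#|T| - (k + j.+1))%:R * c.
  rewrite (le_trans bT) // (ler_wpM2r (ltW c0)) // ler_nat leq_sub2l //.
  by rewrite ml leq_add2l ltnS leq_addr.
move: (k + j.+1)%:R (_ - _)%:R bk bT => K N bk bT.
have C0 : 0 <= c ^+ (k + j) by rewrite exprn_ge0 ?ltW.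
rewrite !addnS !exprSr; move: (c ^+ _) C0 => C C0.
(* [t] is [h j + h j.+2], that is 2 (h j.+1 - 1). As (j + 1)(l + 1) >= j + l + 1 = m, the loss of 1
   is at most the fraction 1/m of [h j.+1]. *)
pose t : R := ((j.+1 * l.+1)%:R - 1) * 2%:R.
apply: (@le_trans _ _ (b * c * C * t)).
  rewrite [leLHS](_ : _ =
    b * c * C * (2%:R * ((1 - m%:R^-1) * (j.+1 * l.+1)%:R))); last by ring.
  have bcC : 0 <= b * c * C by rewrite !mulr_ge0 // ltW.
  rewrite ler_wpM2l // /t mulrC ler_wpM2r // mulrBl mul1r lerD2l lerN2.
  rewrite mulrC ler_pdivlMr ?ltr0n // mul1r ler_nat ml; nia.
have -> : b * c * C * t =
    b * c * (C * (j * l.+2)%:R) + b * (C * c * (j.+2 * l)%:R).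
  by rewrite /t !natrM -!natr1; ring.
apply: lerD; first by rewrite ler_wpM2r ?mulr_ge0.
rewrite [leRHS](_ : _ = N * c * (C * c * (j.+2 * l)%:R)); last by ring.
by rewrite ler_wpM2r ?mulr_ge0 // ltW.
Qed.

Lemma sqr_sum_le_card (R : realFieldType) (I : finType) (A : {set I}) (f : I -> R) :
  (forall i, f i != 0 -> i \in A) ->
  (\sum_i f i) ^+ 2 <= #|A|%:R * \sum_i f i ^+ 2.
Proof.
move=> fA.
have sumA (h : R -> R) : h 0 = 0 -> \sum_i h (f i) = \sum_(i in A) h (f i).
  move=> h0; rewrite [RHS]big_mkcond; apply: eq_bigr => i _.
  by case: ifPn => // /(contraNN (fA i)) /negPn/eqP ->.
rewrite (sumA id) // (sumA (fun y => y ^+ 2)) ?expr0n // expr2 big_distrlr /=.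
(* Symmetrized, Cauchy-Schwarz follows termwise from 2ab <= a^2 + b^2. *)
have -> : #|A|%:R * \sum_(i in A) f i ^+ 2 =
    \sum_(i in A) \sum_(j in A) (f i ^+ 2 + f j ^+ 2) / 2%:R.
  under [RHS]eq_bigr do rewrite -mulr_suml big_split /= sumr_const.
  rewrite -mulr_suml big_split /= sumr_const sumrMnl.
  by rewrite -(mulr_natl _ #|A|); field.
apply: ler_sum => i _; apply: ler_sum => j _.
have := sqr_ge0 (f i - f j); lra.
Qed.

(** With [lam - mu >= 1], [spectral_bound] gives |P| s2 <= |T| s^2, where s and s2 are the sums of f
    and f^2; Cauchy-Schwarz gives s^2 <= |B| s2, and s2 > 0 cancels. *)
Lemma card_le_ball (R : realFieldType) (T U : finType) (P : pred U) (u0 : U)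
    (e : U -> T -> R) (mu c b : R) (k m : nat) :
  (forall u i, e u i ^+ 2 = 1) ->
  P u0 -> (forall i, e u0 i = 1) ->
  (forall X Y,
    0 <= \sum_(u | P u) character (e u) X * character (e u) Y) ->
  (forall u, P u -> u != u0 -> \sum_i e u i <= mu) ->
  (0 < m)%N -> (k + m <= #|T|)%N -> 0 < c -> 0 <= b ->
  b * c <= k%:R -> b <= (#|T| - (k + m))%:R * c ->
  0 <= mu -> mu + 1 <= 2%:R * b * (1 - m%:R^-1) ->
  #|P|%:R <= #|T|%:R * #|[set X : {set T} | (#|X| < (k + m).+1)%N]|%:R :> R.
Proof.
move=> e2 Pu0 e0 K0 emu m0 kmT c0 b0 bk bT mu0 mulam.
have [f [f0 [X0 fX0] fsupp flam]] := shell_test_function m0 kmT c0 b0 bk bT.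
have fball X : f X != 0 -> X \in [set X : {set T} | (#|X| < (k + m).+1)%N].
  by rewrite inE ltnS; apply: fsupp.
have f2_gt0 : 0 < \sum_X f X ^+ 2.
  rewrite (bigD1 X0) //= ltr_pwDl ?sumr_ge0 // => [|X _]; last by rewrite sqr_ge0.
  by rewrite lt_def sqr_ge0 sqrf_eq0 fX0.
have := spectral_bound e2 Pu0 e0 K0 emu f0 flam.
have := sqr_sum_le_card fball.
move: (\sum_X f X ^+ 2) (\sum_X f X) f2_gt0 => s2 s s2_gt0 CS SB.
rewrite -(ler_pM2r s2_gt0) -mulrA.
apply: (@le_trans _ _ (#|T|%:R * s ^+ 2)); last by rewrite ler_wpM2l.
move: (2%:R * b * _) mulam SB => lam mulam SB.
have {}SB : (lam - mu) * (#|P|%:R * s2) <= (#|T|%:R - mu) * s ^+ 2.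
  by apply: SB; lra.
have Ps2 : 0 <= (lam - mu - 1) * (#|P|%:R * s2).
  apply: mulr_ge0; [lra | by rewrite mulr_ge0 // ltW].
have mus : 0 <= mu * s ^+ 2 by rewrite mulr_ge0 ?sqr_ge0.
lra.
Qed.

(** * Numerical estimates *)

Lemma lt_nat_exists (R : archiRealFieldType) (K : R) : exists n : nat, K < n%:R.
Proof.
exists (Num.bound `|K|).
exact: le_lt_trans (ler_norm K) (archi_boundP (normr_ge0 K)).
Qed.

Lemma linear_lt_expr (R : archiRealFieldType) (K : R) :
  exists q0 : nat, forall q : nat, (q0 <= q)%N ->
    K * q.+1%:R < (9%:R / 8%:R) ^+ q.
Proof.
(* The first three terms of the binomial expansion of (1 + 1/8)^q. *)
have quad (q : nat) :
    1 + q%:R / 8%:R + q%:R * (q%:R - 1) / 128%:R <= (9%:R / 8%:R) ^+ q :> R.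
  elim: q => [|q IHq]; first by rewrite expr0; lra.
  rewrite exprS -natr1.
  have : 0 <= q%:R * (q%:R - 1) :> R.
    by case: q {IHq} => [|q]; rewrite ?mul0r // -natr1 addrK mulr_ge0 // addr_ge0.
  lra.
have [q0 q0P] := lt_nat_exists (256%:R * `|K| + 2%:R).
exists q0 => q q0q; apply: lt_le_trans (quad q).
have {q0P q0q} : 256%:R * `|K| + 2%:R < q%:R.
  by rewrite (lt_le_trans q0P) // ler_nat.
rewrite -[q.+1%:R]natr1; have := ler_norm K; have := ler0n R q.
move: `|K| (q%:R : R) => k y y0 Kk ky.
have y2 : 0 <= y * y by rewrite mulr_ge0.
have : 0 <= (k - K) * (y + 1) by apply: mulr_ge0; lra.
have : 0 <= (y - 2%:R - 256%:R * k) * (y + 1) by apply: mulr_ge0; lra.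
lra.
Qed.

(* 23 (1 - 2 H(5/46)) > log2(9/8), where H is the binary entropy. *)
Lemma entropy_gap (R : realFieldType) (q : nat) :
  (9%:R / 8%:R) ^+ q * (46%:R / 41%:R) ^+ (46 * q) <=
  2%:R ^+ (23 * q) * (5%:R / 41%:R) ^+ (5 * q) :> R.
Proof.
have gap : 9%:R / 8%:R * (46%:R / 41%:R) ^+ 46 <=
    2%:R ^+ 23 * (5%:R / 41%:R) ^+ 5 :> R by lra.
rewrite ![_ ^+ (_ * q)]exprM -!exprMn lerXn2r // nnegrE.
  by rewrite mulr_ge0 ?exprn_ge0 ?divr_ge0.
by rewrite mulr_ge0 ?exprn_ge0 ?divr_ge0.
Qed.

(** 5/41 is the optimal Chernoff parameter d / (1 - d) at d = 5/46. Replacing p by 23 q costs at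
    most the factors 92 (q + 1) and (46/41)^46, which the (9/8)^q of [entropy_gap] absorbs. *)
Lemma ball_eventually_small (R : archiRealFieldType) :
  exists q0 : nat, forall (q p : nat) (B : R),
  (q0 <= q)%N -> (23 * q <= p < 23 * q.+1)%N ->
  B * (5%:R / 41%:R) ^+ (5 * q) <= (1 + 5%:R / 41%:R) ^+ (2 * p) ->
  4%:R * p%:R * B < 2%:R ^+ p.
Proof.
pose x : R := 5%:R / 41%:R; pose y : R := 46%:R / 41%:R.
have xy : 1 + 5%:R / 41%:R = y by rewrite /y; lra.
have x_gt0 : 0 < x by rewrite /x; lra.
have y_gt1 : 1 < y by rewrite /y; lra.
have [q0 q0P] := linear_lt_expr (92%:R * y ^+ 46).
exists q0 => q p B q0q /andP[qp pq]; rewrite xy -/x => ballB.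
have := entropy_gap R q; rewrite -/x -/y; have := q0P q q0q.
clear q0P xy; move: x y x_gt0 y_gt1 ballB => x y x_gt0 y_gt1 ballB qsmall gap.
have y_ge1 : 1 <= y by rewrite ltW.
have y0 n : 0 < y ^+ n by rewrite exprn_gt0 // (lt_trans _ y_gt1).
have x0 n : 0 < x ^+ n by rewrite exprn_gt0.
rewrite -(ltr_pM2r (x0 (5 * q)%N)) -(mulrA (4%:R * p%:R)).
apply: (@le_lt_trans _ _ (4%:R * p%:R * y ^+ (2 * p))).
  by rewrite ler_wpM2l ?mulr_ge0.
apply: (@le_lt_trans _ _ (92%:R * q.+1%:R * (y ^+ 46 * y ^+ (46 * q)))).
  rewrite -exprD; apply: ler_pM; rewrite ?mulr_ge0 ?(ltW (y0 _)) //.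
    by rewrite -!natrM ler_nat; lia.
  by apply: ler_weXn2l => //; lia.
apply: (@lt_le_trans _ _ ((9%:R / 8%:R) ^+ q * y ^+ (46 * q))).
  by rewrite mulrA ltr_pM2r // mulrAC.
apply: (le_trans gap); rewrite ler_wpM2r ?(ltW (x0 _)) //.
by apply: ler_weXn2l => //; rewrite ler1n.
Qed.

(** * The quadratic character of a finite field *)

Definition legendre (R : realFieldType) (F : finFieldType) (c : F) : R :=
  if c == 0 then 0 else if [exists b : F, c == b ^+ 2] then 1 else -1.

(** The unit group is cyclic, so with a generator g every nonzero element is a square or g times a
    square; thus two non-squares have a square product. *)
Lemma legendreM (R : realFieldType) (F : finFieldType) :
  {morph @legendre R F : a b / a * b}.
Proof.
have [g gP] : exists g : F, forall c,
    c != 0 -> exists b, c = b ^+ 2 \/ c = g * b ^+ 2.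
  have /cyclicP[u uP] := field_unit_group_cyclic [set: {unit F}]%G.
  exists (val u) => c c0; have cU : c \is a GRing.unit by rewrite unitfE.
  have /cycleP[k ck] : FinRing.unit F cU \in <[u]>%g by rewrite -uP inE.
  exists (val u ^+ k./2); rewrite -exprM muln2 -exprS.
  have -> : c = val u ^+ k by rewrite -FinRing.val_unitX -ck.
  by rewrite -[in val u ^+ k](odd_double_half k); case: (odd k); [right | left].
move=> a b; rewrite /legendre mulf_eq0.
have [-> | a0] /= := eqVneq a 0; first by rewrite mul0r.
case: (eqVneq b 0) => [_ | b0] /=; first by rewrite mulr0.
case: ifPn => [/existsP[z /eqP abz] | Nab];
  case: ifPn => [/existsP[x /eqP ax] | Na];
  case: ifPn => [/existsP[y /eqP bY] | Nb];
  rewrite ?mulr1 ?mul1r ?mulrNN ?mulr1 //.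
- case/existsP: Nb; exists (z / x); move: a0; rewrite ax expf_eq0 /= => x0.
  by rewrite exprMn exprVn -abz ax mulrAC divff ?mul1r ?expf_neq0.
- case/existsP: Na; exists (z / y); move: b0; rewrite bY expf_eq0 /= => y0.
  by rewrite exprMn exprVn -abz bY mulfK ?expf_neq0.
- by case/existsP: Nab; exists (x * y); rewrite ax bY exprMn.
have [x [ax | ax]] := gP a a0; first by case/existsP: Na; exists x; rewrite -ax.
have [y [bY | bY]] := gP b b0; first by case/existsP: Nb; exists y; rewrite -bY.
by case/existsP: Nab; exists (g * x * y); rewrite ax bY; apply/eqP; ring.
Qed.

Lemma legendre_prod (R : realFieldType) (F : finFieldType) (I : finType)
    (S : {set I}) (h : I -> F) :
  legendre R (\prod_(i in S) h i) = \prod_(i in S) legendre R (h i).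
Proof.
apply: (big_morph _ (@legendreM R F)); rewrite /legendre oner_eq0.
by case: ifPn => // /existsP[]; exists 1; rewrite expr1n.
Qed.

Lemma card_sqrt (R : realFieldType) (F : finFieldType) (c : F) :
  2%:R != 0 :> F ->
  #|[set y : F | y ^+ 2 == c]|%:R = 1 + legendre R c.
Proof.
move=> two0; rewrite /legendre; have [-> | c0] := eqVneq c 0.
  rewrite (_ : [set _ | _] = [set 0]) ?cards1 ?addr0 //.
  by apply/setP => y; rewrite !inE sqrf_eq0.
case: ifPn => [/existsP[b /eqP cb] | Nc].
  have b0 : b != 0 by move: c0; rewrite cb sqrf_eq0.
  have bN : b != - b by rewrite -subr_eq0 opprK -mulr2n -mulr_natl mulf_neq0.
  rewrite (_ : [set _ | _] = [set b; - b]) ?cards2 ?bN //.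
  by apply/setP => y; rewrite !inE cb eqf_sqr.
rewrite subrr (_ : [set _ | _] = set0) ?cards0 //.
apply/setP => y; rewrite !inE; apply: contraNF Nc => /eqP <-.
by apply/existsP; exists y.
Qed.

(** * Codeword signs and point counts *)

Definition residue_sign (R : realFieldType) (p : nat) (b : bool) (t : 'F_p) : R :=
  if t \in (if b then quad_residues p else quad_nonresidues p) then -1 else 1.

Lemma residue_sign_sqr (R : realFieldType) (p : nat) b (t : 'F_p) :
  residue_sign R b t ^+ 2 = 1.
Proof. by rewrite /residue_sign; case: ifP; rewrite ?sqrrN expr1n. Qed.

Lemma residue_sign_nonresidue (R : realFieldType) (p : nat) (t : 'F_p) :
  t != 0 -> residue_sign R false t = legendre R t.
Proof.
move=> t0; rewrite /residue_sign /legendre inE (negbTE t0) /=.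
by case: ifP; case: ifP.
Qed.

Lemma residue_signM (R : realFieldType) (p : nat) (t : 'F_p) :
  residue_sign R true t * residue_sign R false t = if t == 0 then 1 else -1.
Proof.
rewrite /residue_sign !inE; case: eqP => _ /=; first by rewrite mulr1.
by case: ifP => _ /=; rewrite ?mulr1 ?mul1r.
Qed.

(* The coordinates of (-1)^c for the codeword c of S: [true] selects the block
   of Q, [false] that of N. *)
Definition codeword_sign (R : realFieldType) (p : nat) (S : {set 'F_p})
    (bx : bool * 'F_p) : R :=
  \prod_(a in S) residue_sign R bx.1 (bx.2 - a).

Lemma codeword_sign_sqr (R : realFieldType) (p : nat) (S : {set 'F_p}) bx :
  codeword_sign R S bx ^+ 2 = 1.
Proof.
by rewrite /codeword_sign -prodrXl big1 // => a _; rewrite residue_sign_sqr.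
Qed.

(** Q and N partition the nonzero elements, so each a <> x in S contributes -1; with |S| even, their
    number is odd exactly when x is in S. *)
Lemma codeword_signM (R : realFieldType) (p : nat) (S : {set 'F_p}) x :
  ~~ odd #|S| ->
  codeword_sign R S (true, x) * codeword_sign R S (false, x) =
  if x \in S then -1 else 1.
Proof.
move=> evS; rewrite /codeword_sign -big_split /=.
under eq_bigr do rewrite residue_signM.
case: ifP => xS.
  rewrite (big_setD1 x) //= subrr eqxx mul1r (eq_bigr (fun=> -1)).
    rewrite prodr_const -signr_odd; move: evS; rewrite (cardsD1 x S) xS /= negbK.
    by move=> ->.
  by move=> a; rewrite !inE subr_eq0 eq_sym => /andP[/negbTE ->].
rewrite (eq_bigr (fun=> -1)) => [|a aS].
  by rewrite prodr_const -signr_odd (negbTE evS).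
by rewrite subr_eq0; case: eqP aS => // <-; rewrite xS.
Qed.

(** For x in S the two signs cancel and f_S(x) = 0. Otherwise they agree, and the N-sign is the
    character of f_S(x). *)
Lemma codeword_sign_legendre (R : realFieldType) (p : nat) (S : {set 'F_p}) x :
  ~~ odd #|S| ->
  codeword_sign R S (true, x) + codeword_sign R S (false, x) =
  2%:R * legendre R (f_ S).[x].
Proof.
move=> evS; have := codeword_signM R x evS; case: ifP => xS eM.
  rewrite /f_ horner_prod (bigD1 x) //= hornerXsubC subrr mul0r /legendre eqxx mulr0.
  have := codeword_sign_sqr R S (true, x); have := codeword_sign_sqr R S (false, x).
  move: (codeword_sign _ _ _) (codeword_sign _ _ _) eM => u v; nra.
have -> : codeword_sign R S (true, x) = codeword_sign R S (false, x).
  have := codeword_sign_sqr R S (true, x); have := codeword_sign_sqr R S (false, x).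
  move: (codeword_sign _ _ _) (codeword_sign _ _ _) eM => u v; nra.
rewrite -mulr2n -[LHS]mulr_natl /f_ horner_prod legendre_prod /codeword_sign.
congr (_ * _).
apply: eq_bigr => a aS; rewrite hornerXsubC residue_sign_nonresidue // subr_eq0.
by case: eqP aS => // <-; rewrite xS.
Qed.

Lemma card_affine_points (R : realFieldType) (p : nat) (S : {set 'F_p}) :
  prime p -> (2 < p)%N -> ~~ odd #|S| ->
  2%:R * #|affine_points S|%:R = (2 * p)%:R + \sum_bx codeword_sign R S bx.
Proof.
move=> pp p2 evS.
have two0 : 2%:R != 0 :> 'F_p.
  by rewrite -(dvdn_pcharf (pchar_Fp pp)) gtnNdvd.
rewrite -(pair_big xpredT xpredT (fun b x => codeword_sign R S (b, x))) /=.
rewrite big_bool /= -big_split /=.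
under eq_bigr do rewrite codeword_sign_legendre //.
rewrite -mulr_sumr natrM -mulrDr; congr (_ * _).
rewrite -sum1_card natr_sum.
rewrite (eq_bigl (fun xy : 'F_p * 'F_p =>
    xpredT xy.1 && (xy.2 ^+ 2 == (f_ S).[xy.1]))).
  rewrite -(pair_big_dep xpredT (fun x y => y ^+ 2 == (f_ S).[x])
    (fun _ _ => 1%:R)) /=.
  rewrite (eq_bigr (fun x => 1 + legendre R (f_ S).[x])) => [|x _].
    by rewrite big_split /= sumr_const card_Fp.
  rewrite -card_sqrt // -sum1_card natr_sum; apply: eq_bigl => y.
  by rewrite inE.
by move=> xy; rewrite inE.
Qed.

(** Characters of codewords are multiplicative in S, so this is a sum over even sets of products of
    signs. It takes the place of orthogonality relations for a linear code. *)
Lemma codeword_kernel_ge0 (R : realFieldType) (p : nat) (X Y : {set bool * 'F_p}) :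
  0 <= \sum_(S : {set 'F_p} | ~~ odd #|S|)
    character (codeword_sign R S) X * character (codeword_sign R S) Y.
Proof.
pose m (Z : {set bool * 'F_p}) (a : 'F_p) : R :=
  \prod_(bx in Z) residue_sign R bx.1 (bx.2 - a).
have charE (S : {set 'F_p}) (Z : {set bool * 'F_p}) :
    character (codeword_sign R S) Z = \prod_(a in S) m Z a.
  by rewrite /character exchange_big.
under eq_bigr do rewrite !charE -big_split.
apply: sum_even_prod_ge0 => a; rewrite exprMn -!prodrXl !big1 ?mulr1 // => bx _;
  exact: residue_sign_sqr.
Qed.

(** * Choice of parameters and conclusion *)

Lemma exists_large_card_X (R : archiRealFieldType) :
  exists p0 : nat, forall p : nat, prime p -> (p0 < p)%N ->
    exists S : {set 'F_p},
      S != set0 /\ 81%:R / 50%:R * p%:R < (card_X S)%:R :> R.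
Proof.
have [q0 q0P] := ball_eventually_small R.
have [m mE] : exists m : nat, m = 1000%N by eexists.
have m0 : (0 < m)%N by rewrite mE.
have {}mE : m%:R = 1000%:R :> R by rewrite mE.
have [q1 q1P] := lt_nat_exists (300%:R * m%:R : R).
exists (23 * (q0 + q1).+1)%N => p pp p0.
(* Then n = 2p is about 46 q, and the radius n * 5/46 is about 5 q. *)
pose q := (p %/ 23)%N.
have qp : (23 * q <= p)%N by rewrite /q; lia.
have pq : (p < 23 * q.+1)%N by rewrite /q; lia.
have q0q : (q0 <= q)%N by lia.
have q1q : (q1 <= q)%N by lia.
have {p0} p2 : (2 < p)%N by lia.
have {q1P q1q} ql : 300%:R * m%:R < q%:R :> R.
  by apply: lt_le_trans q1P _; rewrite ler_nat.
have [/existsP[S /andP[S0 SX]] | ] :=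
    boolP [exists S : {set 'F_p},
      (S != set0) && (81%:R / 50%:R * p%:R < (card_X S)%:R :> R)].
  by exists S.
rewrite negb_exists => /forallP noS; exfalso.
have {}noS (S : {set 'F_p}) : S != set0 ->
    (card_X S)%:R <= 81%:R / 50%:R * p%:R :> R.
  by move=> S0; have := noS S; rewrite S0 /= -leNgt.
have mq : (m.+1 <= 5 * q)%N by rewrite -(ler_nat R) natrM -natr1; lra.
have [k km] : exists k, (k + m).+1 = (5 * q)%N.
  by exists (5 * q - m.+1)%N; rewrite -addnS subnK.
have kE : k%:R = 5%:R * q%:R - (m%:R + 1) :> R.
  by rewrite -natrM -km -addnS natrD natr1 addrK.
have cT : #|{: bool * 'F_p}| = (2 * p)%N by rewrite card_prod card_bool card_Fp.
have qpR : 23%:R * q%:R <= p%:R :> R by rewrite -natrM ler_nat.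
have pqR : p%:R <= 23%:R * q%:R + 23%:R :> R.
  by rewrite -natrM -natrD ler_nat; lia.
have cardP : #|[pred S : {set 'F_p} | ~~ odd #|S|]|%:R <=
    (2 * p)%:R * #|[set X : {set bool * 'F_p} | (#|X| < 5 * q)%N]|%:R :> R.
  (* 7/20 approximates sqrt(5/41), the value suited to the radius n * 5/46. *)
  rewrite -cT -km; apply: (@card_le_ball R _ {set 'F_p} _ set0
    (@codeword_sign R p) (31%:R / 25%:R * p%:R)
    (7%:R / 20%:R) (20%:R / 7%:R * k%:R));
    rewrite ?cT //.
  - by move=> S bx; apply: codeword_sign_sqr.
  - by rewrite /= cards0.
  - by move=> bx; rewrite /codeword_sign big_set0.
  - exact: codeword_kernel_ge0.
  (* At most 1.62 p points force a sum of signs of at most 2 * 1.62 p - 2p = 1.24 p. *)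
  - move=> S evS S0; have := noS S S0; have := card_affine_points R pp p2 evS.
    rewrite /card_X natrD natrM.
    have : 0 <= (points_at_infinity S)%:R :> R by [].
    lra.
  - by lia.
  - lra.
  - by rewrite mulr_ge0 ?divr_ge0.
  - lra.
  (* The left side is below (20/7) 5q < 14.29 q, the right side at least (7/20)(46 q - 5 q) = 14.35
     q. *)
  - rewrite natrB; last by lia.
    rewrite natrD natrM; lra.
  - by rewrite mulr_ge0 //; lra.
  (* Up to constants, lam is (200/7)(1 - 1/1000) q > 28.54 q and mu at most 1.24 * 23 q = 28.52 q;
     [ql] makes the gap exceed those constants. *)
  - by rewrite kE mE; lra.
have x01 : (0 <= (5%:R / 41%:R : R)) && ((5%:R / 41%:R : R) <= 1).
  by rewrite divr_ge0 //= ler_pdivrMr ?ltr0n // mul1r ler_nat.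
have := card_ball_bound (bool * 'F_p)%type (5 * q) x01; rewrite cT => ballB.
have qpq : (23 * q <= p < 23 * q.+1)%N by rewrite qp pq.
(* The contradiction: 2^p <= 2 |P| <= 4 p |B| < 2^p. *)
have := q0P _ _ _ q0q qpq ballB; apply/negP; rewrite -leNgt.
apply: le_trans (_ : 2%:R * #|[pred S : {set 'F_p} | ~~ odd #|S|]|%:R <= _).
  by rewrite -natrX -natrM ler_nat -{1}(card_Fp pp) card_even_sets.
rewrite (_ : 4%:R * p%:R = 2%:R * (2 * p)%:R); last by rewrite natrM; ring.
by rewrite -mulrA ler_wpM2l.
Qed.

Theorem corollary3
  (h1 : forall p : nat, prime p -> p = 1 %[mod 4] ->
     is_direct_sum (QQR_code p) (dual_code (QQR_code p)))
  (h3 : forall p : nat, prime p -> p = 3 %[mod 4] ->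
     dual_code (QQR_code p) = QQR_code p) :
  exists p0 : nat, forall p : nat, prime p -> (p0 < p)%N ->
    exists S : {set 'F_p},
      S != set0 /\ 1.62%Q * p%:R < (card_X S)%:R :> rat.
Proof.
have [p0 p0P] := exists_large_card_X rat; exists p0 => p pp p0p.
have -> : 1.62%Q = 81%:R / 50%:R :> rat by apply/eqP; vm_compute.
exact: p0P.
Qed.
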